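(* Let $d\ge 2$ be any integer. Let $P_0$ be the $d\times d$ matrix with entries $(P_0)_{j,k}=d^{-1/2}q^{jk}$, and let $P_1$ be a unitary $d\times d$ matrix such that $V_1=P_1D_1P_1^*$ for some unitary diagonal matrix $D_1$. Then $\{\mathbf 1_d,P_0,P_1\}$ defines a set of three mutually unbiased bases of $\mathbb C^d$; in particular there are at least three mutually unbiased bases in $\mathbb C^d$.
   Context: Rows and columns of $d\times d$ matrices are indexed by $\{0,1,\dots,d-1\}$, and $q=\exp(2i\pi/d)$. $U=\mathrm{diag}(1,q,q^2,\dots,q^{d-1})$. $V$ is the matrix with $V_{j,j+1}=1$ for $0\le j\le d-2$, $V_{d-1,0}=1$ and all other entries $0$. $V_1:=VU$. $\mathbf 1_d$ is the identity matrix. Two orthonormal bases $B,B'$ of $\mathbb C^d$ are mutually unbiased if $|b\cdot b'|=d^{-1/2}$ for all $b\in B$, $b'\in B'$. A unitary matrix defines the orthonormal basis formed by its columns; a set of unitary matrices defines a set of mutually unbiased bases if the bases defined by any two distinct members are mutually unbiased. *)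

(* Defs.v *)
From HB Require Import structures.
From mathcomp Require Import all_boot all_order all_algebra.
From mathcomp Require Import complex.
From mathcomp Require Import all_classical all_reals all_analysis.

Set Implicit Arguments.
Unset Strict Implicit.
Unset Printing Implicit Defensive.

Import Order.TTheory GRing.Theory Num.Theory.
Local Open Scope classical_set_scope.
Local Open Scope ring_scope.
Local Open Scope sesquilinear_scope.
Local Open Scope complex_scope.

Definition cexp (R : realType) (z : R[i]) : R[i] :=
  let: a +i* b := z in (expR a)%:C * (cos b +i* sin b).

Definition qroot (R : realType) (d : nat) : R[i] :=
  cexp (2 * 'i * (pi : R)%:C / d%:R).

Definition clockU (R : realType) (d : nat) : 'M[R[i]]_d :=
  diag_mx (\row_(j < d) qroot R d ^+ j).

Definition shiftV (R : realType) (d : nat) : 'M[R[i]]_d :=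
  \matrix_(j < d, k < d)
    ((k == j.+1 :> nat) || (j == d.-1 :> nat) && (k == 0 :> nat))%:R.

Definition V1mx (R : realType) (d : nat) : 'M[R[i]]_d :=
  shiftV R d *m clockU R d.

Definition P0mx (R : realType) (d : nat) : 'M[R[i]]_d :=
  \matrix_(j < d, k < d) ((sqrtC d%:R)^-1 * qroot R d ^+ (j * k)).

Definition hdot (R : realType) (d : nat) (u v : 'cV[R[i]]_d) : R[i] :=
  \sum_(i < d) Num.conj (u i 0) * v i 0.

(* A basis is treated as an unordered set of column vectors. *)
Definition orthonormal_basis (R : realType) (d : nat)
    (B : set 'cV[R[i]]_d) : Prop :=
  (exists X : seq 'cV[R[i]]_d, basis_of fullv X /\ B = [set` X]) /\
  (forall u v, B u -> B v -> hdot u v = (u == v)%:R).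

Definition mutually_unbiased (R : realType) (d : nat)
    (B B' : set 'cV[R[i]]_d) : Prop :=
  [/\ orthonormal_basis B, orthonormal_basis B' &
      forall b b', B b -> B' b' -> `|hdot b b'| = (sqrtC d%:R)^-1].

Definition mub_set (R : realType) (d : nat)
    (F : set (set 'cV[R[i]]_d)) : Prop :=
  (forall B, F B -> orthonormal_basis B) /\
  (forall B B', F B -> F B' -> B <> B' -> mutually_unbiased B B').

Definition column_basis (R : realType) (d : nat) (M : 'M[R[i]]_d) :
    set 'cV[R[i]]_d :=
  [set col j M | j in [set: 'I_d]].

Definition defines_mub_set (R : realType) (d : nat)
    (S : set 'M[R[i]]_d) : Prop :=
  (forall M, S M -> M \is unitarymx) /\
  (forall M N, S M -> S N -> M <> N ->
     mutually_unbiased (column_basis M) (column_basis N)).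

(* Main.v *)
Require Import Defs.
From mathcomp Require Import all_boot all_order all_algebra.
From mathcomp Require Import complex.
From mathcomp Require Import all_classical all_reals all_analysis.
From mathcomp Require Import lra zify.
Import Order.TTheory GRing.Theory Num.Theory.
Local Open Scope classical_set_scope.
Local Open Scope ring_scope.
Local Open Scope sesquilinear_scope.
Local Open Scope complex_scope.
Local Open Scope card_scope.

(** A unitary matrix N whose entries satisfy |N (i+1) j| = |N i j| (indices mod
d) has all its entries of modulus d^(-1/2). The columns of P1 are eigenvectors
of V1 = V U with unimodular eigenvalues, and V1 permutes the coordinates
cyclically up to unimodular factors, so this applies to N = P1. Conjugation by
P0 exchanges the roles of clock and shift, V U P0 = P0 U V^T, so the columns of
P0^* P1 are eigenvectors of U V^T, which is again a cyclic shift up to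
unimodular factors; hence it also applies to N = P0^* P1, with no evaluation of
Gauss sums. Such a P1 exists by the spectral theorem, V1 being unitary. *)

(** * The root of unity q and its exact order *)

Lemma trig_exprn (R : realType) (t : R) (n : nat) :
  (cos t +i* sin t) ^+ n = cos (t *+ n) +i* sin (t *+ n).
Proof.
elim: n => [|n IHn]; first by rewrite expr0 mulr0n cos0 sin0.
rewrite exprS IHn mulrS cosD sinD; simpc.
by congr (_ +i* _); rewrite [LHS]addrC [sin t * _]mulrC// [in RHS]addrC.
Qed.

Lemma qrootE (R : realType) (d : nat) :
  qroot R d = cos (2 * pi / d%:R) +i* sin (2 * pi / d%:R).
Proof.
have -> : qroot R d = cexp (0 +i* (2 * pi / d%:R)).
  congr cexp; rewrite -complexiE -!(rmorph_nat (real_complex R)) -fmorphV.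
  by simpc.
by rewrite /cexp expR0 mul1r.
Qed.

(** By the half-angle formula, 1 - cos t = 2 sin^2 (t/2), and t/2 lies strictly between 0 and pi,
    where the sine is positive. *)
Lemma cos_lt1 (R : realType) (t : R) : 0 < t < pi *+ 2 -> cos t < 1.
Proof.
move=> t02; have -> : t = (t / 2) *+ 2 by lra.
have : 0 < sin (t / 2) by apply: sin_gt0_pi; lra.
move/(exprn_gt0 2); rewrite sin2cos2 cos_mulr2n; lra.
Qed.

Lemma qroot_prim (R : realType) (d : nat) :
  (0 < d)%N -> d.-primitive_root (qroot R d).
Proof.
move=> d_gt0; rewrite /primitive_root_of_unity d_gt0 /=.
have dR_gt0 : 0 < d%:R :> R by rewrite ltr0n.
have qd : qroot R d ^+ d = 1.
  rewrite qrootE trig_exprn -(mulr_natr (2 * pi / _)) divfK ?lt0r_neq0//.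
  by rewrite mulr_natl cos2pi sin2pi.
suff q_neq1 m : (0 < m < d)%N -> qroot R d ^+ m != 1.
  apply/forallP => i; rewrite unity_rootE; apply/eqP.
  have [->|ne_id] := eqVneq i.+1 d; first by rewrite qd eqxx.
  apply/negbTE; by rewrite q_neq1//= ltn_neqAle ne_id ltn_ord.
(* Comparing real parts suffices: the angle 2 pi m / d lies strictly between 0 and 2 pi, so its
   cosine is less than 1. *)
move=> /andP[m_gt0 lt_md]; rewrite qrootE trig_exprn eq_complex /= negb_and.
rewrite lt_eqF// cos_lt1// -(mulr_natr (2 * pi / _)) mulrAC divr_gt0 ?mulr_gt0 ?pi_gt0 ?ltr0n//=.
by rewrite ltr_pdivrMr// -(mulr_natl pi) ltr_pM2l ?ltr_nat// mulr_gt0 ?pi_gt0.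
Qed.

Lemma norm_qroot (R : realType) (d : nat) : `|qroot R d| = 1.
Proof. by rewrite qrootE normc_def /= cos2Dsin2 sqrtr1. Qed.

(** * The cyclic shift acting on rows and columns *)

Lemma shiftVE (R : realType) (d : nat) (i j : 'I_d) :
  shiftV R d i j = (j == ordS i)%:R.
Proof.
rewrite mxE; congr (_ : bool)%:R.
rewrite -val_eqE /=.
(* Before the last row only the clause [k == j.+1] can hold. In the last row it is impossible and
   the wrap-around clause gives column 0. *)
have [lt_id|] := ltnP i.+1 d.
  rewrite modn_small// (_ : (i == d.-1 :> nat) = false) ?orbF//.
  by case: d i j lt_id => // d i j; rewrite ltnS => /ltn_eqF.
case: d i j => [[]//|d] i j; rewrite ltnS => le_di.
have -> : i = d :> nat by apply/eqP; rewrite eqn_leq le_di -ltnS ltn_ord.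
by rewrite modnn eqxx /= [_ == d.+1](ltn_eqF (ltn_ord j)).
Qed.

Lemma mul_shiftV (R : realType) (d m : nat) (M : 'M[R[i]]_(d, m)) i k :
  (shiftV R d *m M) i k = M (ordS i) k.
Proof.
rewrite mxE (bigD1 (ordS i))//= shiftVE eqxx mul1r big1 ?addr0// => j /negPf ne_j.
by rewrite shiftVE ne_j mul0r.
Qed.

Lemma mul_shiftVT (R : realType) (d m : nat) (M : 'M[R[i]]_(m, d)) k i :
  (M *m (shiftV R d)^T) k i = M k (ordS i).
Proof. by rewrite -[M]trmxK -trmx_mul mxE mul_shiftV !mxE. Qed.

(** The transpose moves rows the opposite way. Indexing the result by [ordS i] avoids a cyclic
    predecessor and still compares rows [i] and [ordS i]. *)
Lemma mul_shiftVT_ordS (R : realType) (d m : nat) (M : 'M[R[i]]_(d, m)) i k :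
  ((shiftV R d)^T *m M) (ordS i) k = M i k.
Proof.
rewrite mxE (bigD1 i)//= mxE shiftVE eqxx mul1r big1 ?addr0// => j ne_j.
by rewrite mxE shiftVE (inj_eq (@ordS_inj _)) eq_sym (negPf ne_j) mul0r.
Qed.

(** The map [ordS] is a single cycle: every index is reached from 0 by repeated successors. *)
Lemma ordS_invariant_const (T : Type) (d : nat) (f : 'I_d -> T) :
  (forall i, f (ordS i) = f i) -> forall i j, f i = f j.
Proof.
case: d f => [f _ []//|d] f fS.
suff f0 m (lt_md : (m < d.+1)%N) : f (Ordinal lt_md) = f ord0.
  by move=> [i lt_i] [j lt_j]; rewrite !f0.
elim: m lt_md => [|m IHm] lt_md; first by congr f; apply: val_inj.
rewrite -(IHm (ltnW lt_md)) -[RHS]fS; congr f; apply: val_inj => /=.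
by rewrite modn_small.
Qed.

(** * Hermitian products and entries of unitary matrices *)

Lemma hdot_col (R : realType) (d : nat) (M N : 'M[R[i]]_d) i j :
  hdot (col i M) (col j N) = (M^t* *m N) i j.
Proof. by rewrite /hdot mxE; apply: eq_bigr => k _; rewrite !mxE. Qed.

Lemma normr_hdotC (R : realType) (d : nat) (u v : 'cV[R[i]]_d) :
  `|hdot v u| = `|hdot u v|.
Proof.
rewrite -norm_conjC rmorph_sum; congr `|_|; apply: eq_bigr => k _ /=.
by rewrite rmorphM/= conjCK mulrC.
Qed.

Lemma unitarymx_mulCV (C : numClosedFieldType) (d : nat) (M : 'M[C]_d) :
  M \is unitarymx -> M^t* *m M = 1%:M.
Proof. by move=> /unitarymxP/mulmx1C. Qed.

(** Moduli are constant along each column, which is a unit vector with d entries; hence each squared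
    modulus is 1/d. *)
Lemma unitarymx_norm_const (R : realType) (d : nat) (M : 'M[R[i]]_d) :
  M \is unitarymx -> (forall i j, `|M (ordS i) j| = `|M i j|) ->
  forall i j, `|M i j| = (sqrtC d%:R)^-1.
Proof.
move=> Mu MS i j.
have /matrixP/(_ j j) := @unitarymx_mulCV _ _ _ Mu.
rewrite !mxE eqxx (eq_bigr (fun=> `|M i j| ^+ 2)) => [|k _]; last first.
  rewrite !mxE mulrC -normCK.
  by rewrite (@ordS_invariant_const _ _ (fun i => `|M i j|) (MS^~ j) k i).
rewrite sumr_const card_ord -(mulr_natr (_ ^+ 2)) => Md1.
have d_neq0 : d%:R != 0 :> R[i] by case: d i {M Mu MS j Md1} => [[]//|d _]; rewrite pnatr_eq0.
rewrite -[LHS](@sqrCK R[i])// (canRL (mulfK d_neq0) Md1) mul1r.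
apply: (@mulfI _ (sqrtC d%:R)); rewrite ?sqrtC_eq0//.
by rewrite -sqrtCM ?qualifE/= ?invr_ge0 ?ler0n// !mulfV ?sqrtC_eq0// sqrtC1.
Qed.

Lemma unitary_diag_norm (C : numClosedFieldType) (d : nat) (r : 'rV[C]_d) :
  diag_mx r \is unitarymx -> forall i, `|r 0 i| = 1.
Proof.
move=> /unitarymxP/matrixP ru i; have := ru i i.
rewrite tr_diag_mx map_diag_mx mulmx_diag !mxE !eqxx !mulr1n -normCK => /eqP.
by rewrite (@pexpr_eq1 _ _ 2)// => /eqP.
Qed.

Lemma diag_unitary (C : numClosedFieldType) (d : nat) (r : 'rV[C]_d) :
  (forall i, `|r 0 i| = 1) -> diag_mx r \is unitarymx.
Proof.
move=> r1; apply/unitarymxP/matrixP => i j.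
rewrite tr_diag_mx map_diag_mx mulmx_diag !mxE -normCK r1 expr1n.
by rewrite -mulr_natr mul1r.
Qed.

(** * Unitarity of U, V, V1 and the Fourier matrix P0 *)

Lemma clockU_unitary (R : realType) (d : nat) : clockU R d \is unitarymx.
Proof.
by apply: diag_unitary => i; rewrite mxE normrX norm_qroot expr1n.
Qed.

Lemma shiftV_unitary (R : realType) (d : nat) : shiftV R d \is unitarymx.
Proof.
apply/unitarymxP/matrixP => i j; rewrite mul_shiftV mxE [in LHS]mxE shiftVE mxE.
by rewrite (inj_eq (@ordS_inj _)) rmorph_nat.
Qed.

Lemma V1mx_unitary (R : realType) (d : nat) : V1mx R d \is unitarymx.
Proof. by rewrite mul_unitarymx ?shiftV_unitary ?clockU_unitary. Qed.

Lemma qroot_ordS (R : realType) (d : nat) (i : 'I_d) :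
  qroot R d ^+ ordS i = qroot R d ^+ i.+1.
Proof.
have qp : d.-primitive_root (qroot R d) by apply: qroot_prim; case: d i => [[]|].
by rewrite (prim_expr_mod qp).
Qed.

Lemma P0mx_unitary (R : realType) (d : nat) : (0 < d)%N -> P0mx R d \is unitarymx.
Proof.
move=> d_gt0; apply/unitarymxP/matrixP => i j.
have qp := qroot_prim R d d_gt0; set q := qroot R d in qp *.
have d_neq0 : d%:R != 0 :> R[i] by rewrite pnatr_eq0 -lt0n.
have q_neq0 : q != 0 by rewrite -normr_eq0 norm_qroot oner_eq0.
have qJ : q^-1 = Num.conj q by rewrite invC_norm norm_qroot expr1n invr1 mul1r.
(* Since q has modulus 1, its conjugate is its inverse, so entry (i, j) of P0 P0^* is the average of
   the powers w^k for k < d. *)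
pose w := q ^+ i / q ^+ j.
rewrite !mxE (eq_bigr (fun k : 'I_d => d%:R^-1 * w ^+ k)) => [|k _]; last first.
  rewrite !mxE rmorphM rmorphXn /= -/q -qJ !conj_Creal ?rpredV ?sqrtC_real ?ler0n//.
  rewrite mulrACA -invfM -expr2 sqrtCK /w.
  by rewrite expr_div_n -!exprM exprVn.
rewrite -mulr_sumr; case: eqVneq => [eq_ij|ne_ij].
  rewrite /w eq_ij divff ?expf_neq0// (eq_bigr (fun=> 1)) => [|k _]; last exact: expr1n.
  by rewrite sumr_const card_ord mulVf.
have w_neq1 : w - 1 != 0.
  rewrite subr_eq0; apply: contra_neq ne_ij => w1; apply/val_inj/eqP.
  have /eqP : q ^+ i = q ^+ j by rewrite -[LHS](@divfK _ (q ^+ j)) ?expf_neq0// -/w w1 mul1r.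
  by rewrite (eq_prim_root_expr qp) !modn_small.
(* The geometric sum telescopes to w^d - 1 = 0, and w - 1 is nonzero by primitivity of q. *)
have : (w - 1) * \sum_(k < d) w ^+ k = 0.
  rewrite -subrX1 expr_div_n -!exprM ![(_ * d)%N]mulnC !exprM.
  by rewrite (prim_expr_order qp) !expr1n divr1 subrr.
by move=> /eqP; rewrite mulf_eq0 (negPf w_neq1) => /eqP ->; rewrite mulr0.
Qed.

(** * Exchange of clock and shift, and moduli of eigenvectors *)

Lemma V1mx_P0mx (R : realType) (d : nat) :
  V1mx R d *m P0mx R d = P0mx R d *m (clockU R d *m (shiftV R d)^T).
Proof.
apply/matrixP => i k; rewrite -mulmxA mul_shiftV mulmxA mul_shiftVT.
rewrite mul_diag_mx mul_mx_diag !mxE mulrCA -mulrA; congr (_ * _).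
(* Up to the factor d^(-1/2), both entries are q^((i+1)(k+1)). Reduction modulo d in [ordS] is
   harmless because q^d = 1. *)
rewrite [in RHS]mulnC !exprM !qroot_ordS -!exprM -!exprD; congr (_ ^+ _); lia.
Qed.

(** Taking moduli in an entry of the eigenvector equation removes the unimodular factors from [u]
    and [D] and leaves |N (i+1) j| = |N i j|. The two alternatives serve P1 and P0^* P1
    respectively. *)
Lemma eigen_norm_const (R : realType) (d : nat) (u D : 'rV[R[i]]_d) (N : 'M[R[i]]_d) :
  (forall i, `|u 0 i| = 1) -> diag_mx D \is unitarymx -> N \is unitarymx ->
  shiftV R d *m diag_mx u *m N = N *m diag_mx D \/
  diag_mx u *m (shiftV R d)^T *m N = N *m diag_mx D ->
  forall i j, `|N i j| = (sqrtC d%:R)^-1.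
Proof.
move=> u1 /unitary_diag_norm D1 Nu NE; apply: unitarymx_norm_const => // i j.
case: NE => /matrixP.
- move=> /(_ i j); rewrite -mulmxA mul_shiftV mul_diag_mx mul_mx_diag !mxE.
  by move=> /(congr1 Num.norm); rewrite !normrM u1 D1 mul1r mulr1.
- move=> /(_ (ordS i) j); rewrite -mulmxA mul_diag_mx mul_mx_diag.
  by rewrite [LHS]mxE [RHS]mxE mul_shiftVT_ordS => /(congr1 Num.norm);
    rewrite !normrM u1 D1 mul1r mulr1.
Qed.

(** * From unitary matrices to unbiased bases *)

Lemma column_basis_orthonormal (R : realType) (d : nat) (M : 'M[R[i]]_d) :
  M \is unitarymx -> orthonormal_basis (column_basis M).
Proof.
move=> Mu; have colM i j : hdot (col i M) (col j M) = (i == j)%:R.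
  by rewrite hdot_col unitarymx_mulCV// mxE.
split; last first.
  move=> _ _ [i _ <-] [j _ <-]; rewrite colM.
  have [->|ne_ij] := eqVneq i j; first by rewrite eqxx.
  case: eqVneq => // eq_col.
  have := colM i j; rewrite eq_col colM eqxx (negPf ne_ij).
  by move=> /eqP; rewrite oner_eq0.
exists [seq col j M | j <- enum 'I_d]; split; last first.
  apply/seteqP; split => [_ [j _ <-]|v] /=; first by apply: map_f; rewrite mem_enum.
  by move=> /mapP[j _ ->]; exists j.
(* There are d columns, so spanning is enough; the coordinates of v in the columns of M are the
   entries of M^* v. *)
rewrite basisEdim size_map size_enum_ord dimvf /dim /= muln1 leqnn andbT.
apply/subvP => v _.
have -> : v = M *m (M^t* *m v) by rewrite mulmxA (unitarymxP Mu) mul1mx.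
have -> (w : 'cV[R[i]]_d) : M *m w = \sum_j w j 0 *: col j M.
  apply/matrixP => i k; rewrite ord1 mxE summxE; apply: eq_bigr => j _.
  by rewrite !mxE mulrC.
apply: rpred_sum => j _; rewrite rpredZ// memv_span//.
by apply: map_f; rewrite mem_enum.
Qed.

Lemma column_basis_unbiased (R : realType) (d : nat) (M N : 'M[R[i]]_d) :
  M \is unitarymx -> N \is unitarymx ->
  (forall i j, `|(M^t* *m N) i j| = (sqrtC d%:R)^-1) ->
  mutually_unbiased (column_basis M) (column_basis N).
Proof.
move=> Mu Nu MN; split; try exact: column_basis_orthonormal.
by move=> _ _ [i _ <-] [j _ <-]; rewrite hdot_col MN.
Qed.

Lemma mutually_unbiased_sym (R : realType) (d : nat) (B B' : set 'cV[R[i]]_d) :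
  mutually_unbiased B B' -> mutually_unbiased B' B.
Proof.
by case=> oB oB' ub; split=> // b b' Bb B'b'; rewrite normr_hdotC ub.
Qed.

(** If the two bases coincided, a unit vector paired with itself would give 1 = d^(-1/2), that is d
    = 1. This ensures that the three bases are counted without repetition. *)
Lemma unbiased_column_basis_neq (R : realType) (d : nat) (M N : 'M[R[i]]_d) :
  (2 <= d)%N -> mutually_unbiased (column_basis M) (column_basis N) ->
  column_basis M <> column_basis N.
Proof.
case: d M N => // d M N d_ge2 [[_ oM] _ ub] eqMN.
have M0 : column_basis M (col ord0 M) by exists ord0.
have := ub _ _ M0 (eq_ind _ (@^~ (col ord0 M)) M0 _ eqMN).
rewrite oM// eqxx normr1 => /(congr1 (fun x => x ^- 2)).
rewrite expr1n invr1 exprVn invrK sqrtCK => /eqP.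
by rewrite (eqr_nat _ 1) => /eqP eq1d; rewrite -eq1d in d_ge2.
Qed.

Lemma card_eq_set3 (T : Type) (a b c : T) :
  a <> b -> a <> c -> b <> c -> [set a; b; c] #= `I_3.
Proof.
(* Removing c and then b leaves a singleton. *)
move=> ab ac bc; apply/eq_cardSP; exists c; first by right.
apply/eq_cardSP; exists b; first by split; [left; right|].
rewrite (_ : _ `\` _ = [set a]) ?card_set1//.
by apply/seteqP; split => [x [[[[]|]]]//|x ->]; split => //; split => //; left; left.
Qed.

Lemma column_basis_1_unbiased (R : realType) (d : nat) (M : 'M[R[i]]_d) :
  M \is unitarymx -> (forall i j, `|M i j| = (sqrtC d%:R)^-1) ->
  mutually_unbiased (column_basis 1%:M) (column_basis M).
Proof.
move=> Mu M1; apply: column_basis_unbiased => //.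
  by apply/unitarymxP; rewrite trmx1 map_mx1 mul1mx.
by move=> i j; rewrite trmx1 map_mx1 mul1mx.
Qed.

Lemma norm_P0mx (R : realType) (d : nat) i j :
  `|P0mx R d i j| = (sqrtC d%:R)^-1.
Proof.
rewrite mxE normrM normrX norm_qroot expr1n mulr1.
by rewrite ger0_norm// invr_ge0 sqrtC_ge0 ler0n.
Qed.

(** * Eigenbases of V1: unbiasedness and existence *)

Lemma V1mx_eigenbasis_unbiased (R : realType) (d : nat) (P1 D1 : 'M[R[i]]_d) :
  (0 < d)%N -> P1 \is unitarymx -> D1 \is unitarymx -> is_diag_mx D1 ->
  V1mx R d = P1 *m D1 *m P1^t* ->
  mutually_unbiased (column_basis 1%:M) (column_basis P1) /\
  mutually_unbiased (column_basis (P0mx R d)) (column_basis P1).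
Proof.
move=> d_gt0 P1u D1u /diag_mxP[D D1E] V1E; rewrite {}D1E in D1u V1E.
have P0u := P0mx_unitary R d d_gt0.
have V1P1 : V1mx R d *m P1 = P1 *m diag_mx D by rewrite V1E mulmxKtV.
have u1 (i : 'I_d) : `|(\row_(j < d) qroot R d ^+ j) 0 i| = 1.
  by rewrite mxE normrX norm_qroot expr1n.
split.
  by apply: column_basis_1_unbiased => //; apply: eigen_norm_const u1 D1u P1u _; left.
apply: column_basis_unbiased => //.
apply: (eigen_norm_const _ _ _ _ _ u1 D1u); first by rewrite mul_unitarymx ?trmxC_unitary.
(* Replacing P1 D by V1 P1 and cancelling P1 leaves U V^T P0^* = P0^* V1, which is the exchange
   relation multiplied by P0^* on both sides. *)
right; rewrite -/(clockU R d) -[RHS]mulmxA -V1P1 [LHS]mulmxA [RHS]mulmxA; congr (_ *m _).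
rewrite -[RHS](mulmxtVK _ P0u) -[in RHS](mulmxA _ (V1mx R d)) V1mx_P0mx.
by rewrite [in RHS]mulmxA unitarymx_mulCV// mul1mx.
Qed.

Lemma V1mx_unitary_diagonalizable (R : realType) (d : nat) :
  exists2 P1 : 'M[R[i]]_d, P1 \is unitarymx &
    exists D1 : 'M[R[i]]_d,
      [/\ D1 \is unitarymx, is_diag_mx D1 & V1mx R d = P1 *m D1 *m P1^t*].
Proof.
have V1u := V1mx_unitary R d.
have /orthomx_spectralP : V1mx R d \is normalmx.
  by apply/normalmxP; rewrite (unitarymxP V1u) unitarymx_mulCV.
set P := spectralmx _; set D := diag_mx _ => V1E.
have Pu : P \is unitarymx by apply: spectral_unitarymx.
rewrite invmx_unitary// in V1E.
(* The spectral theorem gives V1 = P^* D P, so the eigenvector matrix is P^*. Solving for D exhibits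
   it as a product of unitary matrices. *)
have DE : D = P *m V1mx R d *m P^t*.
  by rewrite V1E !mulmxA (unitarymxP Pu) mul1mx mulmxtVK.
exists (P^t*); first by rewrite trmxC_unitary.
exists D; split; rewrite ?diag_mx_is_diag//.
  rewrite DE; apply: mul_unitarymx; last by rewrite trmxC_unitary.
  exact: mul_unitarymx.
by rewrite trmxCK.
Qed.

Theorem corollary2p8 (R : realType) (d : nat) (hd : (2 <= d)%N) :
  (forall P1 : 'M[R[i]]_d,
     P1 \is unitarymx ->
     (exists D1 : 'M[R[i]]_d,
        [/\ D1 \is unitarymx, is_diag_mx D1 &
            V1mx R d = P1 *m D1 *m P1 ^t*]) ->
     defines_mub_set [set 1%:M; P0mx R d; P1] /\
     [set column_basis M | M in [set 1%:M; P0mx R d; P1]] #= `I_3) /\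
  (exists F : set (set 'cV[R[i]]_d), mub_set F /\ `I_3 #<= F).
Proof.
have d_gt0 : (0 < d)%N by apply: ltnW.
have P0u := P0mx_unitary R d d_gt0.
set S := fun P1 => [set 1%:M; P0mx R d; P1].
have mubS (P1 : 'M[R[i]]_d) : P1 \is unitarymx ->
    (exists D1 : 'M[R[i]]_d,
       [/\ D1 \is unitarymx, is_diag_mx D1 & V1mx R d = P1 *m D1 *m P1^t*]) ->
    defines_mub_set (S P1) /\ [set column_basis M | M in S P1] #= `I_3.
  move=> P1u [D1 [D1u D1d V1E]].
  have ub10 := column_basis_1_unbiased _ _ _ P0u (norm_P0mx R d).
  have [ub11 ub01] := V1mx_eigenbasis_unbiased _ _ _ _ d_gt0 P1u D1u D1d V1E.
  split; last first.
    (* The three bases are pairwise distinct because they are pairwise unbiased and d >= 2. *)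
    rewrite /S !image_setU !image_set1.
    by apply: card_eq_set3; apply: unbiased_column_basis_neq.
  split; first by move=> M [[->|->]|->]//; apply/unitarymxP; rewrite trmx1 map_mx1 mul1mx.
  by move=> M N [[->|->]|->] [[->|->]|->] // _; apply: mutually_unbiased_sym.
split; first exact: mubS.
(* For the existence claim, any unitary diagonalization of V1 supplies the third basis. *)
have [P1 P1u /(mubS _ P1u)[[Su Sub] S3]] := V1mx_unitary_diagonalizable R d.
exists [set column_basis M | M in S P1]; split; last first.
  by move: S3; rewrite card_eq_le => /andP[].
split; first by move=> _ [M SM <-]; apply/column_basis_orthonormal/Su.
by move=> _ _ [M SM <-] [N SN <-] neq; apply: Sub => // eqMN; rewrite eqMN in neq.
Qed.
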